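(* Let $R$ be a Noetherian ring and let $I_1,\ldots,I_s \subseteq R$ be ideals of positive grade. For each $i=1,\ldots,s$, consider a generating set $\{f_{ij} \mid j=1,\ldots,n_i\}$ of $I_i$ which contains at least one nonzerodivisor $f_{ij_i}$, and set $h=\prod_{i=1}^s f_{ij_i}$. Consider the indeterminates $\underline{Y}=\{Y_{ij} \mid i=1,\ldots,s,\ j=1,\ldots,n_i\}$ and $\underline{T}=(T_1,\ldots,T_s)$ over $R$, and define the $R$-algebra homomorphism $$\varphi: R[\underline{Y}] \to \mathcal{R}(I_1,\ldots,I_s) \subseteq R[\underline{T}], \qquad Y_{ij} \mapsto f_{ij}T_i \quad \text{for all } i=1,\ldots,s,\ j=1,\ldots,n_i.$$ Then the ideal $$\Gamma := \langle Y_{ij}f_{ij'} - Y_{ij'}f_{ij} \mid i=1,\ldots,s \text{ and } j,j' \in \{1,\ldots,n_i\} \text{ with } j\neq j' \rangle : h^\infty \subseteq R[\underline{Y}]$$ is the defining ideal of $\mathcal{R}(I_1,\ldots,I_s)$, that is, $\Gamma = \ker \varphi$.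
   Context: Rings are commutative with identity. For ideals $I_1,\ldots,I_s$ of a Noetherian ring $R$, the multi-Rees algebra is the subring $$\mathcal{R}(I_1,\ldots,I_s) = R[I_1T_1,\ldots,I_sT_s] = \bigoplus_{a_1,\ldots,a_s\ge 0} I_1^{a_1}\cdots I_s^{a_s}\, T_1^{a_1}\cdots T_s^{a_s} \subseteq R[T_1,\ldots,T_s].$$ The grade of an ideal $J$ in a Noetherian ring $B$ is the common length of the maximal $B$-regular sequences contained in $J$. For an ideal $L$ of $R[\underline{Y}]$ and $h\in R$, $L:h^\infty = \{g \in R[\underline{Y}] \mid h^m g \in L \text{ for some } m\ge 0\}$ is the saturation of $L$ with respect to $h$. *)

(* Defs.v *)
From HB Require Import structures.
From mathcomp Require Import all_boot all_order all_algebra.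
From mathcomp Require Import boolp.
From mathcomp Require Import mpoly.
Set Implicit Arguments.
Unset Strict Implicit.
Unset Printing Implicit Defensive.
Import GRing.Theory.
Local Open Scope ring_scope.

Section Ideals.
Variable A : comNzRingType.
Implicit Types (S J : A -> Prop) (xs : seq A).

(* Prop-valued and possibly improper, unlike the [idealr] of MathComp, which is
   decidable and proper. *)
Definition is_ideal J : Prop :=
  [/\ J 0, forall x y, J x -> J y -> J (x + y) & forall a x, J x -> J (a * x)].

Definition ideal_gen S (x : A) : Prop :=
  exists (r : nat) (a g : 'I_r -> A),
    (forall k, S (g k)) /\ x = \sum_(k < r) a k * g k.

Definition seq_ideal xs : A -> Prop := ideal_gen (fun x => x \in xs).

Definition noetherian : Prop :=
  forall J, is_ideal J -> exists xs, forall x, J x <-> seq_ideal xs x.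

Definition regular_seq xs : Prop :=
  (forall k, (k < size xs)%N -> forall y,
     seq_ideal (take k xs) (xs`_k * y) -> seq_ideal (take k xs) y)
  /\ ~ seq_ideal xs 1.

Definition regular_seq_in J xs : Prop :=
  regular_seq xs /\ (forall x, x \in xs -> J x).

Definition maximal_regular_seq_in J xs : Prop :=
  regular_seq_in J xs /\ forall x, ~ regular_seq_in J (rcons xs x).

(* [Some k] is the grade k; [None] is the infinite grade, by convention that
   of the unit ideal. *)
Definition has_grade J (k : option nat) : Prop :=
  match k with
  | Some k' =>
      [/\ ~ J 1, exists xs, maximal_regular_seq_in J xs
        & forall xs, maximal_regular_seq_in J xs -> size xs = k']
  | None => J 1
  end.

Definition positive_grade J : Prop :=
  exists2 k, has_grade J k & k <> Some 0%N.

End Ideals.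

Section MultiRees.
Variables (R : comNzRingType) (s : nat) (I : 'I_s -> R -> Prop).

(* Membership in R[I_1 T_1, ..., I_s T_s], the smallest R-subalgebra of
   R[T_1, ..., T_s] that contains every c T_i with c in I_i. *)
Definition multi_rees_pred : {pred {mpoly R[s]}} := fun p =>
  `[< forall B : {pred {mpoly R[s]}}, GRing.subalg_closed B ->
      (forall i c, I i c -> c *: 'X_i \in B) -> p \in B >].

Lemma multi_rees_closed : GRing.subalg_closed multi_rees_pred.
Proof.
split.
- by apply/asboolP => B [].
- move=> a u v /asboolP hu /asboolP hv; apply/asboolP => B hB hI.
  by case: (hB) => _ hl _; apply: hl; [apply: hu | apply: hv].
- move=> u v /asboolP hu /asboolP hv; apply/asboolP => B hB hI.
  by case: (hB) => _ _ hm; apply: hm; [apply: hu | apply: hv].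
Qed.

HB.instance Definition _ :=
  GRing.isSubalgClosed.Build R {mpoly R[s]} multi_rees_pred multi_rees_closed.

Record multi_rees : Type := MultiRees {
  multi_rees_val :> {mpoly R[s]};
  _ : multi_rees_val \in multi_rees_pred }.

HB.instance Definition _ := [isSub for multi_rees_val].
HB.instance Definition _ := [Choice of multi_rees by <:].
HB.instance Definition _ := [SubChoice_isSubComNzRing of multi_rees by <:].
HB.instance Definition _ := [SubZmodule_isSubLmodule of multi_rees by <:].
HB.instance Definition _ :=
  [SubNzRing_SubLmodule_isSubLalgebra of multi_rees by <:].
HB.instance Definition _ := [SubLalgebra_isSubAlgebra of multi_rees by <:].

End MultiRees.

Definition nvars (s : nat) (n : 'I_s -> nat) : nat :=
  #|{: {i : 'I_s & 'I_(n i)}}|.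

Definition varY (R : comNzRingType) (s : nat) (n : 'I_s -> nat)
    (i : 'I_s) (j : 'I_(n i)) : {mpoly R[nvars n]} :=
  'X_(enum_rank (Tagged (fun i => 'I_(n i)) j)).

Definition rees_relation (R : comNzRingType) (s : nat) (n : 'I_s -> nat)
    (f : forall i : 'I_s, 'I_(n i) -> R) (p : {mpoly R[nvars n]}) : Prop :=
  exists (i : 'I_s) (j j' : 'I_(n i)),
    j != j' /\ p = f i j' *: varY R j - f i j *: varY R j'.

Definition saturation (R : comNzRingType) (N : nat)
    (L : {mpoly R[N]} -> Prop) (h : R) (g : {mpoly R[N]}) : Prop :=
  exists m : nat, L (h ^+ m *: g).

Definition is_rees_map (R : comNzRingType) (s : nat) (I : 'I_s -> R -> Prop)
    (n : 'I_s -> nat) (f : forall i : 'I_s, 'I_(n i) -> R)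
    (phi : {lrmorphism {mpoly R[nvars n]} -> multi_rees I}) : Prop :=
  forall (i : 'I_s) (j : 'I_(n i)), val (phi (varY R j)) = f i j *: 'X_i.

Section ReesMap.
Variables (R : comNzRingType) (s : nat) (I : 'I_s -> R -> Prop).
Variables (n : 'I_s -> nat) (f : forall i : 'I_s, 'I_(n i) -> R).
Hypothesis genI :
  forall i x, I i x <-> ideal_gen (fun y => exists j, y = @f i j) x.

Let h (k : 'I_(nvars n)) : {mpoly R[s]} :=
  f (tagged (enum_val k)) *: 'X_(tag (enum_val k)).

Let multi_rees_h k : h k \in multi_rees_pred I.
Proof.
apply/asboolP => B _; apply; apply/genI.
exists 1%N, (fun=> 1), (fun=> f (tagged (enum_val k))).
by split=> [_|]; [exists (tagged (enum_val k)) | rewrite big_ord1 mul1r].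
Qed.

Let mmap_multi_rees p : mmap (@mpolyC s R) h p \in multi_rees_pred I.
Proof.
rewrite /mmap rpred_sum // => m _; rewrite mul_mpolyC rpredZ //.
by rewrite /mmap1 rpred_prod // => k _; rewrite rpredX.
Qed.

Let phi0 p : multi_rees I := MultiRees (mmap_multi_rees p).

Lemma rees_map_exists :
  exists phi : {lrmorphism {mpoly R[nvars n]} -> multi_rees I},
    is_rees_map f phi.
Proof.
have add : zmod_morphism phi0 by move=> p q; apply: val_inj; rewrite /= raddfB.
have mul : monoid_morphism phi0.
  split=> [|p q]; apply: val_inj; rewrite /= ?rmorph1 ?rmorphM //.
have scal : scalable phi0.
  by move=> a p; apply: val_inj; rewrite /= mmapZ mul_mpolyC.
pose Fz := GRing.isZmodMorphism.Build _ _ phi0 add.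
pose Fm := GRing.isMonoidMorphism.Build _ _ phi0 mul.
pose Fl := GRing.isScalable.Build R _ _ _ phi0 scal.
pose phi : {lrmorphism {mpoly R[nvars n]} -> multi_rees I} :=
  HB.pack phi0 Fz Fm Fl.
exists phi => i j /=.
by rewrite /varY mmapX mmap1U /h enum_rankK.
Qed.

Lemma rees_map_surj (phi : {lrmorphism {mpoly R[nvars n]} -> multi_rees I}) :
  is_rees_map f phi -> forall q, exists p, phi p = q.
Proof.
move=> phiY q; pose B : {pred {mpoly R[s]}} :=
  fun q' => `[< exists p, val (phi p) = q' >].
have : val q \in B.
  have /asboolP := valP q; apply; first split.
  - by apply/asboolP; exists 1; rewrite rmorph1.
  - move=> a _ _ /asboolP[u <-] /asboolP[v <-]; apply/asboolP.
    by exists (a *: u + v); rewrite linearP.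
  - move=> _ _ /asboolP[u <-] /asboolP[v <-]; apply/asboolP.
    by exists (u * v); rewrite rmorphM.
  move=> i c /genI[r [a [b [hb ->]]]]; apply/asboolP.
  have /choice[J hJ] := hb.
  exists (\sum_(k < r) a k *: varY R (J k)).
  rewrite !linear_sum /= scaler_suml; apply: eq_bigr => k _.
  by rewrite !linearZ /= phiY hJ scalerA.
by move=> /asboolP[p hp]; exists p; apply: val_inj.
Qed.

End ReesMap.

(* Main.v *)
Require Import Defs.
From mathcomp Require Import all_boot all_order all_algebra.
From mathcomp Require Import mpoly ring.
Set Implicit Arguments.
Unset Strict Implicit.
Unset Printing Implicit Defensive.
Import GRing.Theory.
Local Open Scope ring_scope.

(** Write [a i = f i (j0 i)] for the chosen nonzerodivisors, [h] for their
    product, [L] for the ideal generated by the relations, and [theta] for the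
    map [_ \mPo pivotY] : R[T] -> R[Y] that sends [T_i] to [Y_{i, j0 i}].

    The map [phi] kills the relations, so it kills [L], and also [L : h^oo]
    since [h] is a nonzerodivisor on R[T] ([saturation_rees_kernel]).

    Conversely, the relation between [j] and [j0 i] reads
    [a i * Y_ij = f_ij * Y_{i, j0 i}] modulo [L]: after multiplication by
    [h], every variable is congruent to an element of the image of [theta].
    This property passes to sums and products, so for every [g] some
    [h ^ m * g] is congruent modulo [L] to some [theta q]
    ([rees_elimination]).  If [phi g = 0], then [phi (theta q) = 0].  But
    [phi \o theta] is the substitution [T_i := a i T_i], which multiplies each
    coefficient by a product of nonzerodivisors and is therefore injective
    ([comp_mpoly_scaleX_inj]).  Hence [q = 0], and [h ^ m * g] lies in [L]. *)

Section IdealGen.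
Variable A : comNzRingType.
Implicit Types (S : A -> Prop).

Lemma ideal_gen_is_ideal S : is_ideal (ideal_gen S).
Proof.
split.
- by exists 0%N, (fun=> 0), (fun=> 0); split=> [[]//|]; rewrite big_ord0.
- move=> _ _ [r [a [g [gS ->]]]] [r' [a' [g' [gS' ->]]]].
  exists (r + r')%N.
  exists (fun k => match split k with inl i => a i | inr i => a' i end).
  exists (fun k => match split k with inl i => g i | inr i => g' i end).
  split=> [k|]; first by case: (split k).
  rewrite big_split_ord; congr (_ + _); apply: eq_bigr => i _.
    by rewrite -[lshift _ _]/(unsplit (inl i)) unsplitK.
  by rewrite -[rshift _ _]/(unsplit (inr i)) unsplitK.
- move=> b _ [r [a [g [gS ->]]]]; exists r, (fun k => b * a k), g.
  by split=> //; rewrite mulr_sumr; apply: eq_bigr => k _; rewrite mulrA.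
Qed.

Lemma mem_ideal_gen S x : S x -> ideal_gen S x.
Proof.
by move=> Sx; exists 1%N, (fun=> 1), (fun=> x); rewrite big_ord1 mul1r.
Qed.

Lemma ideal_gen_rmorph0 (B : comNzRingType) (psi : {rmorphism A -> B}) S x :
  (forall y, S y -> psi y = 0) -> ideal_gen S x -> psi x = 0.
Proof.
move=> S0 [r [a [g [gS ->]]]]; rewrite rmorph_sum big1 // => k _.
by rewrite rmorphM (S0 (g k)) ?mulr0.
Qed.

End IdealGen.

Lemma lreg_prod (A : comNzRingType) (T : Type) (r : seq T) (F : T -> A) :
  (forall i, GRing.lreg (F i)) -> GRing.lreg (\prod_(i <- r) F i).
Proof.
move=> regF; elim: r => [|i r IH]; first by rewrite big_nil; apply: lreg1.
by rewrite big_cons; apply: lregM.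
Qed.

Section MPoly.
Variable R : comNzRingType.

Lemma lreg_scale_mpoly N (a : R) (p : {mpoly R[N]}) :
  GRing.lreg a -> a *: p = 0 -> p = 0.
Proof.
move=> rega ap0; apply/mpolyP => m; rewrite mcoeff0; apply: rega.
by rewrite -mcoeffZ ap0 mcoeff0 mulr0.
Qed.

Lemma mpoly_alg_ind N (P : {mpoly R[N]} -> Prop) :
  (forall c, P c%:MP) -> (forall i, P 'X_i) ->
  (forall p q, P p -> P q -> P (p + q)) ->
  (forall p q, P p -> P q -> P (p * q)) -> forall p, P p.
Proof.
move=> PC PX PD PM; apply: mpolyind => [|c m p _ _ Pp]; first exact: (PC 0).
apply: (PD) => //; rewrite -mul_mpolyC; apply: (PM) => //.
rewrite mpolyXE_id; elim/big_ind: _ => //; first exact: (PC 1).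
move=> i _; elim: (m i) => [|k IH]; first exact: (PC 1).
by rewrite exprS; apply: PM.
Qed.

(** The coefficient at a monomial [m] gets multiplied by the nonzerodivisor
    [\prod_i a i ^+ m i]. *)
Lemma comp_mpoly_scaleX_inj s (a : 'I_s -> R) (q : {mpoly R[s]}) :
  (forall i, GRing.lreg (a i)) ->
  q \mPo [tuple a i *: 'X_i | i < s] = 0 -> q = 0.
Proof.
move=> rega; rewrite comp_mpolyE => q0; apply/mpolyP => m.
rewrite mcoeff0; have [m_q|] := boolP (m \in msupp q); last first.
  exact: memN_msupp_eq0.
have reg_m : GRing.lreg (\prod_i a i ^+ m i).
  by apply: lreg_prod => i; apply: lregX.
have scaleX (m' : 'X_{1..s}) :
    \prod_i tnth [tuple a i *: 'X_i | i < s] i ^+ m' i =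
    (\prod_i a i ^+ m' i) *: 'X_[m'].
  rewrite mpolyXE_id -scaler_prod; apply: eq_bigr => i _.
  by rewrite tnth_mktuple exprZn.
apply: reg_m; rewrite mulr0 -[RHS](mcoeff0 _ m) -q0 raddf_sum /=.
rewrite (bigD1_seq m) ?msupp_uniq //= [X in _ + X]big1 => [|m' ne_m'm].
  by rewrite addr0 scaleX !mcoeffZ mcoeffX eqxx mulr1 mulrC.
by rewrite scaleX !mcoeffZ mcoeffX (negPf ne_m'm) !mulr0.
Qed.

End MPoly.

Section Rees.
Variables (R : comNzRingType) (s : nat) (n : 'I_s -> nat).
Variable f : forall i : 'I_s, 'I_(n i) -> R.
Variable j0 : forall i : 'I_s, 'I_(n i).
Let a i := f (j0 i).
Let h := \prod_(i < s) a i.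
Let L := ideal_gen (rees_relation f).
Let pivotY : s.-tuple {mpoly R[nvars n]} := [tuple varY R (j0 i) | i < s].

Lemma rees_relation_pivot i (j : 'I_(n i)) :
  L (a i *: varY R j - f j *: varY R (j0 i)).
Proof.
have [->|ne_j] := eqVneq j (j0 i).
  by rewrite subrr; case: (ideal_gen_is_ideal (rees_relation f)).
by apply: mem_ideal_gen; exists i, j, (j0 i).
Qed.

(** Over R[1/h] the relations solve for every [Y_ij] in terms of the variables
    [Y_{i, j0 i}]; the exponent [m] clears the denominators. *)
Lemma rees_elimination g : exists m q, L (h ^+ m *: g - (q \mPo pivotY)).
Proof.
have [L0 LD LM] : is_ideal L := ideal_gen_is_ideal _.
elim/mpoly_alg_ind: g => [c|k|p p' [m [q Lp]] [m' [q' Lp']]|].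
- by exists 0%N, c%:MP; rewrite scale1r comp_mpolyC subrr.
- have [[i j] ->] : exists t, k = enum_rank t.
    by exists (enum_val k); rewrite enum_valK.
  (* Multiplying by h rather than by a i leaves this cofactor. *)
  pose b := \prod_(l < s | l != i) a l.
  exists 1%N, ((b * f j) *: 'X_i).
  rewrite comp_mpolyZ comp_mpolyXU -tnth_nth tnth_mktuple.
  have := LM b%:MP _ (rees_relation_pivot j).
  rewrite mul_mpolyC scalerBr !scalerA expr1 /h (bigD1 i) //= -/b.
  by rewrite [b * a i]mulrC.
- exists (m + m')%N, (h ^+ m' *: q + h ^+ m *: q').
  have := LD _ _ (LM (h ^+ m')%:MP _ Lp) (LM (h ^+ m)%:MP _ Lp').
  rewrite comp_mpolyD !comp_mpolyZ !mul_mpolyC !scalerBr !scalerA -!exprD.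
  by rewrite [(m' + m)%N]addnC addrACA -opprD scalerDr.
- move=> p p' [m [q Lp]] [m' [q' Lp']].
  exists (m + m')%N, (q * q').
  have := LD _ _ (LM (h ^+ m *: p) _ Lp') (LM (q' \mPo pivotY) _ Lp).
  rewrite rmorphM /= exprD -scalerA -!mul_mpolyC.
  by congr (L _); ring.
Qed.

Variables (I : 'I_s -> R -> Prop).
Variable phi : {lrmorphism {mpoly R[nvars n]} -> multi_rees I}.
Hypothesis phiY : is_rees_map f phi.

Lemma rees_relations_kernel p : L p -> phi p = 0.
Proof.
apply: ideal_gen_rmorph0 => _ [i [j [j' [_ ->]]]]; apply: val_inj.
by rewrite raddfB /= !linearZ /= scalerN !phiY !scalerA mulrC subrr.
Qed.

Lemma saturation_rees_kernel g :
  GRing.lreg h -> saturation L h g -> phi g = 0.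
Proof.
move=> regh [m /rees_relations_kernel/(congr1 val)]; rewrite linearZ => Lg.
apply: val_inj.
apply: (@lreg_scale_mpoly _ _ (h ^+ m)); first exact: lregX.
exact: Lg.
Qed.

Lemma rees_map_pivot q :
  val (phi (q \mPo pivotY)) = q \mPo [tuple a i *: 'X_i | i < s].
Proof.
rewrite !comp_mpolyE !raddf_sum /=; apply: eq_bigr => m _.
rewrite !linearZ rmorph_prod /=; congr (_ *: _).
rewrite [LHS](rmorph_prod (val : multi_rees I -> _)); apply: eq_bigr => i _.
by rewrite !rmorphXn !tnth_mktuple -phiY.
Qed.

End Rees.

Theorem theorem1p1 (R : comNzRingType) (noethR : noetherian R)
  (s : nat) (I : 'I_s -> R -> Prop)
  (idealI : forall i, is_ideal (I i))
  (gradeI : forall i, positive_grade (I i))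
  (n : 'I_s -> nat) (f : forall i : 'I_s, 'I_(n i) -> R)
  (genI : forall i x, I i x <-> ideal_gen (fun y => exists j, y = f i j) x)
  (j0 : forall i : 'I_s, 'I_(n i))
  (nzdI : forall i, GRing.lreg (f i (j0 i)))
  (phi : {lrmorphism {mpoly R[nvars n]} -> multi_rees I})
  (phiY : is_rees_map f phi)
  (g : {mpoly R[nvars n]}) :
  saturation (ideal_gen (rees_relation f)) (\prod_(i < s) f i (j0 i)) g
  <-> phi g = 0.
Proof.
split=> [|phi_g0].
  by apply: saturation_rees_kernel => //; apply: lreg_prod.
have [m [q Lgq]] := rees_elimination f j0 g; exists m.
suff q0 : q = 0 by move: Lgq; rewrite q0 raddf0 subr0.
apply: (comp_mpoly_scaleX_inj nzdI); rewrite -(rees_map_pivot j0 phiY).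
have /eqP := rees_relations_kernel phiY Lgq.
by rewrite raddfB /= linearZ /= phi_g0 scaler0 sub0r oppr_eq0 => /eqP ->.
Qed.
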